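(* Let $\mathbb{K}$ be a field, let $n\ge 1$, and let $\mathcal{X}\subseteq \mathrm{Mat}(n,\mathbb{K})$ be the set of $n\times n$ X-matrices over $\mathbb{K}$. Then $\mathcal{X}$ is a subring of $\mathrm{Mat}(n,\mathbb{K})$ which is closed under transposition and anti-transposition, i.e. if $A\in\mathcal{X}$ then $A^T\in\mathcal{X}$ and $A^{\tau}\in\mathcal{X}$.
   Context: $\mathrm{Mat}(n,\mathbb{K})$ is the ring of $n\times n$ matrices with entries in the field $\mathbb{K}$. A matrix $A=(a_{i,j})\in\mathrm{Mat}(n,\mathbb{K})$ is an X-matrix if $a_{i,j}=0$ whenever $i\neq j$ and $i+j\neq n+1$. The anti-transpose of $A=(a_{i,j})\in \mathrm{Mat}(n,\mathbb{K})$ is the matrix $A^{\tau}$ with entries $(A^{\tau})_{i,j}=a_{n-j+1,\,n-i+1}$. Subrings are unital: they contain the identity matrix. *)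

(* Defs.v *)
From mathcomp Require Import all_boot all_algebra.

Set Implicit Arguments.
Unset Strict Implicit.
Unset Printing Implicit Defensive.

Import GRing.Theory.
Local Open Scope ring_scope.

(* Indices i, j : 'I_n are 0-based, so the 1-based ones are i.+1 and j.+1. *)
Definition Xmatrix (K : fieldType) (n : nat) : {pred 'M[K]_n} :=
  [pred A : 'M[K]_n |
    [forall i : 'I_n, forall j : 'I_n,
      (i != j) && (i.+1 + j.+1 != n.+1)%N ==> (A i j == 0)]].

(* rev_ord i is n - i.+1, the 0-based form of the 1-based n - i + 1. *)
Definition antitrmx (K : fieldType) (n : nat) (A : 'M[K]_n) : 'M[K]_n :=
  \matrix_(i < n, j < n) A (rev_ord j) (rev_ord i).

(* Main.v *)
Require Import Defs.
From mathcomp Require Import all_boot all_algebra.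

Set Implicit Arguments.
Unset Strict Implicit.
Unset Printing Implicit Defensive.

Import GRing.Theory.
Local Open Scope ring_scope.

(** The X-shape is the graph of an equivalence relation on indices: an index
    is related to itself and to its mirror image, so the classes are the orbits
    of the involution [rev_ord].  X-matrices are the matrices supported on this
    relation, an incidence algebra: reflexivity puts the identity matrix in it,
    transitivity makes it closed under products ([mxsupp_mul]), and symmetry
    makes it closed under transposition.  Anti-transposition only adds to
    transposition a relabelling of the indices by [rev_ord], which preserves
    the relation. *)

Definition xrel n : rel 'I_n := fun i j => (j == i) || (j == rev_ord i).

Lemma xrel_refl n : reflexive (@xrel n).
Proof. by move=> i; rewrite /xrel eqxx. Qed.

Lemma xrel_sym n : symmetric (@xrel n).
Proof.
move=> i j; rewrite /xrel [j == i]eq_sym -(can2_eq rev_ordK rev_ordK).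
by rewrite [rev_ord j == i]eq_sym.
Qed.

Lemma xrel_trans n : transitive (@xrel n).
Proof.
move=> j i k /orP[]/eqP->; rewrite /xrel //.
by rewrite rev_ordK orbC.
Qed.

Lemma xrel_rev n (i j : 'I_n) : xrel (rev_ord i) (rev_ord j) = xrel i j.
Proof. by rewrite /xrel !(inj_eq rev_ord_inj). Qed.

Lemma antidiagE n (i j : 'I_n) :
  (i.+1 + j.+1 == n.+1)%N = (j == rev_ord i).
Proof.
rewrite -val_eqE /= addnS eqSS -[X in _ == X](subnKC (ltn_ord i)).
exact: eqn_add2l.
Qed.

Lemma XmatrixP (K : fieldType) n (A : 'M[K]_n) :
  reflect (forall i j, ~~ xrel i j -> A i j = 0) (A \in @Xmatrix K n).
Proof.
apply: (iffP forallP) => [HA i j | HA i].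
  rewrite negb_or -antidiagE eq_sym => nij.
  by move/forallP/(_ j)/implyP: (HA i) => /(_ nij)/eqP.
apply/forallP => j; apply/implyP; rewrite antidiagE eq_sym -negb_or => nij.
by rewrite HA.
Qed.

(** A nonzero term [A i k * B k j] forces [r i k] and [r k j], hence [r i j]:
    transitivity is all that products need. *)
Lemma mxsupp_mul (R : pzSemiRingType) n (r : rel 'I_n) (A B : 'M[R]_n) :
    transitive r ->
    (forall i j, ~~ r i j -> A i j = 0) ->
    (forall i j, ~~ r i j -> B i j = 0) ->
  forall i j, ~~ r i j -> (A *m B) i j = 0.
Proof.
move=> r_tr A0 B0 i j nij; rewrite mxE big1 // => k _.
have [rik | /A0->] := boolP (r i k); last by rewrite mul0r.
by rewrite B0 ?mulr0 //; apply: contra nij; apply: r_tr.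
Qed.

Theorem proposition11 (K : fieldType) (n : nat) (hn : (0 < n)%N) :
  [/\ subring_closed (@Xmatrix K n),
      (forall A : 'M[K]_n, A \in @Xmatrix K n -> A^T \in @Xmatrix K n)
    & (forall A : 'M[K]_n, A \in @Xmatrix K n -> antitrmx A \in @Xmatrix K n)].
Proof.
split; first split.
- apply/XmatrixP => i j nij; rewrite mxE.
  by case: eqP nij => // ->; rewrite xrel_refl.
- move=> A B /XmatrixP A0 /XmatrixP B0; apply/XmatrixP => i j nij.
  by rewrite !mxE A0 // B0 // subr0.
- move=> A B /XmatrixP A0 /XmatrixP B0; apply/XmatrixP.
  exact: mxsupp_mul (@xrel_trans n) A0 B0.
- move=> A /XmatrixP A0; apply/XmatrixP => i j nij.
  by rewrite mxE A0 // xrel_sym.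
- move=> A /XmatrixP A0; apply/XmatrixP => i j nij.
  by rewrite mxE A0 // xrel_rev xrel_sym.
Qed.
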